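(* Let $K$ be an imaginary quadratic field of discriminant $d_K$, let $\mathfrak{n}$ be a nontrivial (nonzero) ideal of $\mathcal{O}_K$ with least positive integer $N$ and canonical basis $\{a_1\tau_K+a_2,\,N\}$. Let $Q=ax^2+bxy+cy^2$ and $Q'$ be elements of $\mathcal{Q}_N(d_K)$. Then $Q\sim_\mathfrak{n}Q'$ if and only if $$Q=Q'^{\,T^u\gamma T^v}$$ for some $\gamma=\begin{bmatrix}c_1&c_2\\ c_3&c_4\end{bmatrix}\in\Gamma_\mathfrak{n}$ and some $(u,v)\in\mathbb{Z}^2$ satisfying $$c_3v+c_4\equiv1+\widetilde a\left(\frac{a_2}{a_1}-\frac{b_K-b}{2}\right)c_3\pmod N.$$
   Context: $\mathcal{Q}(d_K)$ is the set of primitive positive definite integral binary quadratic forms $ax^2+bxy+cy^2$ of discriminant $d_K$; $\mathcal{Q}_N(d_K)$ is the subset of those with $\gcd(N,a)=1$. For $Q=ax^2+bxy+cy^2$, $\omega_Q=\frac{-b+\sqrt{d_K}}{2a}$ (zero of $Q(x,1)$ in the upper half-plane). For $\gamma\in\mathrm{SL}_2(\mathbb{Z})$, $Q^\gamma$ is the form $Q\left(\gamma\begin{bmatrix}x\\ y\end{bmatrix}\right)$. $[\alpha,\beta]=\mathbb{Z}\alpha+\mathbb{Z}\beta$. $\mathcal{C}(\mathfrak{n})=I_K(\mathfrak{n})/P_{K,1}(\mathfrak{n})$ is the ray class group modulo $\mathfrak{n}$, where $I_K(\mathfrak{n})$ is the group of fractional ideals relatively prime to $\mathfrak{n}$ and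 $P_{K,1}(\mathfrak{n})=\{\nu\mathcal{O}_K\mid\nu\in K^*,\ \nu\equiv^*1\pmod{\mathfrak{n}}\}$. For $Q,Q'\in\mathcal{Q}_N(d_K)$, $Q\sim_\mathfrak{n}Q'$ means that the fractional ideals $[\omega_Q,1]$ and $[\omega_{Q'},1]$ (which are prime to $\mathfrak{n}$) have the same class in $\mathcal{C}(\mathfrak{n})$. $b_K=0$ if $d_K\equiv0\pmod4$ and $b_K=1$ if $d_K\equiv1\pmod4$; $\tau_K=\frac{-b_K+\sqrt{d_K}}{2}$, so $\mathcal{O}_K=[\tau_K,1]$. The canonical basis for $\mathfrak{n}$ is the unique $\mathbb{Z}$-basis of the form $\{a_1\tau_K+a_2,\,N\}$ with integers $0<a_1\leq N$, $0\leq a_2<N$, $a_1\mid N$, $a_1\mid a_2$. $\widetilde a$ is any integer with $a\widetilde a\equiv1\pmod N$. $T=\begin{bmatrix}1&1\\0&1\end{bmatrix}$ and $$\Gamma_\mathfrak{n}=\left\{\begin{bmatrix}c_1&c_2\\ c_3&c_4\end{bmatrix}\in\mathrm{SL}_2(\mathbb{Z})\;\Big|\;c_1\equiv1\ (\mathrm{mod}\ N),\ c_2\equiv0\ \left(\mathrm{mod}\ \tfrac{N}{a_1}\right),\ c_3\equiv0\ (\mathrm{mod}\ a_1),\ c_4\equiv1\ (\mathrm{mod}\ N)\right\}.$$ *)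

(* Defs.v *)
From HB Require Import structures.
From mathcomp Require Import all_boot all_order all_algebra all_field.
From mathcomp Require Import ring boolp classical_sets.

Set Implicit Arguments.
Unset Strict Implicit.
Unset Printing Implicit Defensive.

Import Order.TTheory GRing.Theory Num.Theory.

Local Open Scope classical_set_scope.
Local Open Scope ring_scope.

(* Number fields are subfields of the algebraic complex numbers [algC], and
   lattices, ideals and fractional ideals are subsets of [algC]. *)

Definition imaginary_quadratic (K : set algC) : Prop :=
  exists (F : fieldExtType rat) (iota : {rmorphism F -> algC}),
    [/\ \dim {:F} = 2%N, K = range iota & exists2 z, K z & z \isn't Num.real].

Definition ring_of_integers (K : set algC) : set algC :=
  [set z | K z /\ z \in Aint].

Definition Zspan (w1 w2 : algC) : set algC :=
  [set z | exists m n : int, z = w1 *~ m + w2 *~ n].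

Definition Zbasis (A : set algC) (w1 w2 : algC) : Prop :=
  A = Zspan w1 w2 /\
  forall m n : int, w1 *~ m + w2 *~ n = 0 -> m = 0 /\ n = 0.

(* The two embeddings of an imaginary quadratic field are the inclusion and
   complex conjugation, so the squared expression is
   det [[w1, w1^*], [w2, w2^*]]. *)
Definition discriminant (K : set algC) (d : int) : Prop :=
  exists w1 w2 : algC, Zbasis (ring_of_integers K) w1 w2 /\
    d%:~R = (w1 * w2^* - w2 * w1^*) ^+ 2.

Definition b_of (d : int) : int := if (d %% 4)%Z == 0 then 0 else 1.

(* For negative [d], [sqrtC d%:~R] is the square root with positive
   imaginary part. *)
Definition tau (d : int) : algC := (- (b_of d)%:~R + sqrtC d%:~R) / 2.

(* Integral ideals; the zero ideal and the unit ideal are allowed. *)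
Definition ideal (K A : set algC) : Prop :=
  [/\ A `<=` ring_of_integers K, A 0,
      forall x y, A x -> A y -> A (x + y)
    & forall r x, ring_of_integers K r -> A x -> A (r * x)].

Definition nonzero_ideal (K A : set algC) : Prop :=
  ideal K A /\ exists2 x, A x & x != 0.

Definition ideal_add (A B : set algC) : set algC :=
  [set z | exists x y, [/\ A x, B y & z = x + y]].

Definition ideal_mul (A B : set algC) : set algC :=
  [set z | exists s : seq (algC * algC),
     (forall p, p \in s -> A p.1 /\ B p.2) /\ z = \sum_(p <- s) p.1 * p.2].

Definition principal (K : set algC) (x : algC) : set algC :=
  [set x * r | r in ring_of_integers K].

Definition coprime_ideals (K A B : set algC) : Prop :=
  ideal_add A B = ring_of_integers K.

Definition fractional_ideal (K A : set algC) : Prop :=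
  [/\ A `<=` K,
      exists2 x, A x & x != 0,
      forall x y, A x -> A y -> A (x + y),
      forall r x, ring_of_integers K r -> A x -> A (r * x)
    & exists e, [/\ ring_of_integers K e, e != 0 &
                    forall x, A x -> ring_of_integers K (e * x)]].

(* The group I_K(n): [A] is prime to [n] when it is a quotient B / C of
   nonzero integral ideals prime to [n]. *)
Definition ideals_prime_to (K n : set algC) : set (set algC) :=
  [set A | fractional_ideal K A /\
     exists B C, [/\ nonzero_ideal K B, coprime_ideals K B n,
                     nonzero_ideal K C, coprime_ideals K C n
                   & ideal_mul A C = B]].

(* Multiplicative congruence nu =* 1 (mod n); there is no sign condition
   because an imaginary quadratic field has no real place. *)
Definition mcong1 (K n : set algC) (nu : algC) : Prop :=
  exists x y, [/\ ring_of_integers K x /\ ring_of_integers K y,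
                  x != 0 /\ y != 0,
                  coprime_ideals K (principal K x) n /\
                  coprime_ideals K (principal K y) n,
                  n (x - y)
                & nu = x / y].

(* The ray P_{K,1}(n). *)
Definition ray (K n : set algC) : set (set algC) :=
  [set principal K nu | nu in [set nu | [/\ K nu, nu != 0 & mcong1 K n nu]]].

(* The coset of [A] modulo the ray. *)
Definition ray_class (K n A : set algC) : set (set algC) :=
  [set ideal_mul A P | P in ray K n].

Definition same_ray_class (K n A B : set algC) : Prop :=
  [/\ ideals_prime_to K n A, ideals_prime_to K n B
    & ray_class K n A = ray_class K n B].

Definition least_positive (n : set algC) (N : int) : Prop :=
  [/\ 0 < N, n N%:~R & forall m : int, 0 < m -> n m%:~R -> N <= m].

Definition canonical_basis (d : int) (n : set algC) (N a1 a2 : int) : Prop :=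
  [/\ 0 < a1 <= N, 0 <= a2 < N, (a1 %| N)%Z, (a1 %| a2)%Z
    & Zbasis n (a1%:~R * tau d + a2%:~R) N%:~R].

(* The form a x^2 + b x y + c y^2. *)
Record bqf : Type := Bqf { coefa : int; coefb : int; coefc : int }.

Definition bqf_eval (Q : bqf) (v : 'cV[int]_2) : int :=
  coefa Q * v 0 0 ^+ 2 + coefb Q * v 0 0 * v 1 0 + coefc Q * v 1 0 ^+ 2.

Definition bqf_disc (Q : bqf) : int := coefb Q ^+ 2 - 4 * coefa Q * coefc Q.

Definition primitive (Q : bqf) : Prop :=
  gcdz (gcdz (coefa Q) (coefb Q)) (coefc Q) = 1.

Definition positive_definite (Q : bqf) : Prop :=
  forall v : 'cV[int]_2, v != 0 -> 0 < bqf_eval Q v.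

Definition forms (d : int) : set bqf :=
  [set Q | [/\ primitive Q, positive_definite Q & bqf_disc Q = d]].

Definition forms_prime_to (N d : int) : set bqf :=
  [set Q | forms d Q /\ gcdz N (coefa Q) = 1].

(* Q^g is the form v |-> Q (g v); see [bqf_evalM]. *)
Definition bqf_act (Q : bqf) (g : 'M[int]_2) : bqf :=
  let: Bqf a b c := Q in
  Bqf (a * g 0 0 ^+ 2 + b * g 0 0 * g 1 0 + c * g 1 0 ^+ 2)
      (2 * a * g 0 0 * g 0 1 + b * (g 0 0 * g 1 1 + g 0 1 * g 1 0)
         + 2 * c * g 1 0 * g 1 1)
      (a * g 0 1 ^+ 2 + b * g 0 1 * g 1 1 + c * g 1 1 ^+ 2).

Lemma bqf_evalM (Q : bqf) (g : 'M[int]_2) (v : 'cV[int]_2) :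
  bqf_eval (bqf_act Q g) v = bqf_eval Q (g *m v).
Proof.
case: Q => a b c; rewrite /bqf_eval /= !mxE !big_ord_recl !big_ord0 /= !addr0.
have -> : lift ord0 ord0 = 1 :> 'I_2 by exact/val_inj.
by ring.
Qed.

(* The zero of Q(x, 1) in the upper half-plane, when [Q] is positive
   definite. *)
Definition omega (Q : bqf) : algC :=
  (- (coefb Q)%:~R + sqrtC (bqf_disc Q)%:~R) / (2 * (coefa Q)%:~R).

Definition form_equiv (K n : set algC) (Q Q' : bqf) : Prop :=
  same_ray_class K n (Zspan (omega Q) 1) (Zspan (omega Q') 1).

Definition Tmx : 'M[int]_2 :=
  \matrix_(i, j) if (i == 1) && (j == 0) then 0 else 1.

Definition Gamma (N a1 : int) : set 'M[int]_2 :=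
  [set g : 'M[int]_2 | \det g = 1 /\
     [/\ ((g 0 0)%R = 1 %[mod N])%Z, ((g 0 1)%R = 0 %[mod (N %/ a1)%Z])%Z,
         ((g 1 0)%R = 0 %[mod a1])%Z & ((g 1 1)%R = 1 %[mod N])%Z]].

(* Main.v *)
Require Import Defs.
From HB Require Import structures.
From mathcomp Require Import all_boot all_order all_algebra all_field.
From mathcomp Require Import ring zify boolp classical_sets.

Set Implicit Arguments.
Unset Strict Implicit.
Unset Printing Implicit Defensive.

Import Order.TTheory GRing.Theory Num.Theory.

Local Open Scope classical_set_scope.
Local Open Scope ring_scope.

(* The elements [1] and [nu] of [nu [omega', 1] = [omega, 1]] show that
   [nu = r omega + s] and [omega' = (p omega + q) / (r omega + s)] for a matrix
   [S = (p, q; r, s)] of determinant 1 with [Q = Q'^S], and conversely.  Since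
   [a] is prime to [n], the condition [nu =* 1 mod n] reads [a nu - a \in n];
   as [a omega = tau + (b_K - b) / 2], expanding in the basis of [n] turns it
   into [a1 | r] and [s = 1 + a' (a2 / a1 - (b_K - b) / 2) r mod N].  Finally
   such a matrix [S] is of the form [T^u g T^v] with [g] in [Gamma N a1]. *)

(** * Matrices *)

Lemma mul_mx2E (R : pzRingType) (A B : 'M[R]_2) i j :
  (A * B) i j = A i 0 * B 0 j + A i 1 * B 1 j.
Proof.
rewrite !mxE !big_ord_recl big_ord0 addr0.
by congr (_ + A _ _ * B _ _); apply: val_inj.
Qed.

(** The unipotent matrices [M u] satisfy [M x * M y = M (x + y)]. Induction from [M 1 = Tmx] gives
    the natural powers, and [M (- x)], the inverse of [M x], gives the negative ones. *)
Lemma Tmx_expE (u : int) :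
  Tmx ^ u = \matrix_(i, j) (if i == j then 1 else if i == 0 then u else 0).
Proof.
pose M u : 'M[int]_2 :=
  \matrix_(i, j) (if i == j then 1 else if i == 0 then u else 0).
have M0 : M 0 = 1.
  by apply/matrixP => i j; rewrite !mxE; do 2 case: ifP => _ //.
have MD x y : M x * M y = M (x + y).
  apply/matrixP => i j; rewrite mul_mx2E !mxE.
  by case: i j => [[|[|//]] ?] [[|[|//]] ?] /=; ring.
have M1 : M 1 = Tmx.
  by apply/matrixP => -[[|[|//]] ?] [[|[|//]] ?]; rewrite !mxE.
have Mn (m : nat) : Tmx ^+ m = M m%:Z.
  by elim: m => [|m IHm]; rewrite ?M0 // exprS IHm -M1 MD; congr M; lia.
case: u => m; rewrite -/(M _) /exprz Mn // NegzE.
have U : M m.+1 \is a GRing.unit.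
  by apply/unitrP; exists (M (- m.+1%:Z)); rewrite !MD ?addrN ?addNr M0.
by apply: (mulrI U); rewrite divrr // MD addrN M0.
Qed.

Lemma det_mx2E (R : comPzRingType) (A : 'M[R]_2) :
  \det A = A 0 0 * A 1 1 - A 0 1 * A 1 0.
Proof.
rewrite (expand_det_row _ 0) !big_ord_recl big_ord0 /cofactor !det_mx11 !mxE.
rewrite /= expr0 expr1 mul1r mulN1r mulrN addr0.
by congr (_ * A _ _ - A _ _ * A _ _); apply: val_inj.
Qed.

(* With [v = k] and [u] the upper right entry of [S T^-v], the matrix
   [T^-u S T^-v] lies in [Gamma N a1], its upper right entry being even
   divisible by [N]. *)
Lemma exists_Gamma_conj (N a1 k : int) (P : 'M[int]_2 -> Prop) :
  (a1 %| N)%Z ->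
  (exists (g : 'M[int]_2) (u v : int),
    [/\ Gamma N a1 g,
        ((g 1 0 * v + g 1 1)%R = (1 + k * g 1 0)%R %[mod N])%Z
      & P (Tmx ^ u * g * Tmx ^ v)]) <->
  exists S : 'M[int]_2,
    [/\ \det S = 1, (a1 %| (S 1 0)%R)%Z,
        ((S 1 1)%R = (1 + k * S 1 0)%R %[mod N])%Z & P S].
Proof.
move=> a1N.
have TE u : [/\ (Tmx ^ u) 0 0 = 1, (Tmx ^ u) 0 1 = u, 
    (Tmx ^ u) 1 0 = 0 & (Tmx ^ u) 1 1 = 1].
  by rewrite Tmx_expE !mxE.
have detT u : \det (Tmx ^ u) = 1.
  by rewrite det_mx2E; case: (TE u) => -> -> -> ->; rewrite mulr0 subr0 mulr1.
split=> [[g [u [v [[dg [g00 g01 g10 g11]] gv PS]]]] | [S [dS a1S S11 PS]]].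
  (* Left multiplication by [Tmx ^ u] keeps the bottom row, and right multiplication by [Tmx ^ v]
     turns it into [(g 1 0, g 1 0 * v + g 1 1)]. *)
  exists (Tmx ^ u * g * Tmx ^ v); split=> //.
  - by rewrite !det_mulmx !detT dg.
  - rewrite !mul_mx2E; case: (TE u) => _ _ -> ->; case: (TE v) => -> _ -> _.
    by rewrite !mul0r !add0r mulr0 addr0 mul1r mulr1; apply/dvdz_mod0P;
       rewrite g10 mod0z.
  - rewrite !mul_mx2E; case: (TE u) => _ _ -> ->; case: (TE v) => -> -> -> ->.
    by rewrite !mul0r !add0r mulr0 addr0 !mul1r !mulr1.
pose v := k; pose u := S 0 1 - S 0 0 * v.
pose g := Tmx ^ (- u) * S * Tmx ^ (- v).
have dg : \det g = 1 by rewrite !det_mulmx !detT dS.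
have [g00 g01 g10 g11] : [/\ g 0 0 = S 0 0 - u * S 1 0,
    g 0 1 = u * (1 - (S 1 1 - v * S 1 0)), g 1 0 = S 1 0
    & g 1 1 = S 1 1 - v * S 1 0].
  by rewrite !mul_mx2E; case: (TE (- u)) => -> -> -> ->;
     case: (TE (- v)) => -> -> -> ->; split; rewrite /u; ring.
have /dvdzP[l El] : (N %| (S 1 1 - (1 + k * S 1 0))%R)%Z.
  by rewrite -eqz_mod_dvd; apply/eqP.
have E1 : g 1 1 = 1 + l * N.
  by rewrite g11 -[S 1 1](subrK (1 + k * S 1 0)) El /v; ring.
have E2 : g 0 1 = - (u * l) * N by rewrite g01 -g11 E1; ring.
exists g, u, v; split.
- split=> //; split.
  + apply/eqP; rewrite eqz_mod_dvd; apply/dvdzP.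
    (* This quotient of [g 0 0 - 1] by [N] comes from solving [\det g = 1] for [g 0 0], with
       [g 1 1 = 1 + l * N] and [g 0 1 = - (u * l) * N]. *)
    exists (- u * l * g 1 0 - g 0 0 * l).
    have := dg; rewrite det_mx2E E1 E2 => H.
    by rewrite -[X in _ - X]H; ring.
  + apply/eqP; rewrite eqz_mod_dvd subr0 E2.
    (* With [N = m * a1] the modulus is [m] when [a1] is nonzero; if [a1 = 0] then [N = 0] and the
       entry itself vanishes. *)
    case/dvdzP: a1N => m ->; case: (eqVneq a1 0) => [->|a10].
      by rewrite !mulr0 dvdz0.
    by rewrite mulzK // mulrCA dvdz_mulr.
  + by rewrite g10; apply/eqP; rewrite eqz_mod_dvd subr0.
  + by apply/eqP; rewrite eqz_mod_dvd E1 addrAC subrr add0r dvdz_mull.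
- by rewrite E1 g10 /v; apply/eqP; rewrite eqz_mod_dvd; apply/dvdzP;
     exists l; ring.
suff -> : Tmx ^ u * g * Tmx ^ v = S by [].
apply/matrixP => i j; rewrite !mul_mx2E.
case: (TE (- u)) (TE u) => -> -> -> -> [T00 T01 T10 T11].
case: (TE (- v)) (TE v) => -> -> -> -> [V00 V01 V10 V11].
have E0 (k' : 'I_2) : k' = 0 \/ k' = 1.
  by case: k' => [[|[|//]] ?]; [left|right]; apply: val_inj.
by case: (E0 i) => ->; case: (E0 j) => ->;
   rewrite ?T00 ?T01 ?T10 ?T11 ?V00 ?V01 ?V10 ?V11; ring.
Qed.

(** * The ring of integers *)

(** The additive structure shared by lattices, ideals and rings of integers, so that [Zspan_subset]
    serves them all. *)
Definition subgroup_set (A : set algC) : Prop :=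
  A 0 /\ forall x y, A x -> A y -> A (x - y).

Lemma subgroup_setN A x : subgroup_set A -> A x -> A (- x).
Proof. by case=> A0 AB Ax; rewrite -sub0r; apply: AB. Qed.

Lemma subgroup_setD A x y : subgroup_set A -> A x -> A y -> A (x + y).
Proof.
by move=> hA Ax Ay; rewrite -[y]opprK; apply: hA.2 => //; apply: subgroup_setN.
Qed.

Lemma subgroup_setMz A x m : subgroup_set A -> A x -> A (x *~ m).
Proof.
move=> hA Ax.
have hn (k : nat) : A (x *+ k).
  by elim: k => [|k IHk]; [exact: hA.1 | rewrite mulrS; apply: subgroup_setD].
by case: m => k; [exact: hn | apply: subgroup_setN => //; apply: hn].
Qed.

Lemma Zspan_subset A x y : subgroup_set A -> A x -> A y -> Zspan x y `<=` A.
Proof.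
by move=> hA Ax Ay _ [m [k ->]]; apply: subgroup_setD => //;
   apply: subgroup_setMz.
Qed.

Lemma ZspanP x y z :
  Zspan x y z <-> exists m k : int, z = m%:~R * x + k%:~R * y.
Proof. by split=> -[m [k ->]]; exists m, k; rewrite !mulrzl. Qed.

Lemma subgroup_Zspan x y : subgroup_set (Zspan x y).
Proof.
split; first by exists 0, 0; rewrite !mulr0z addr0.
move=> _ _ /ZspanP[m [k ->]] /ZspanP[m' [k' ->]].
by apply/ZspanP; exists (m - m'), (k - k'); ring.
Qed.

Lemma Zspan_l x y : Zspan x y x.
Proof. by exists 1, 0; rewrite mulr0z addr0. Qed.

Lemma Zspan_r x y : Zspan x y y.
Proof. by exists 0, 1; rewrite mulr0z add0r. Qed.

Lemma eq_Zspan x y z t :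
  Zspan z t x -> Zspan z t y -> Zspan x y z -> Zspan x y t ->
  Zspan x y = Zspan z t.
Proof.
by move=> *; apply/seteqP; split; apply: Zspan_subset => //;
   apply: subgroup_Zspan.
Qed.

Definition subring_set (A : set algC) : Prop :=
  [/\ A 1, forall x y, A x -> A y -> A (x - y)
    & forall x y, A x -> A y -> A (x * y)].

Lemma subring_subgroup A : subring_set A -> subgroup_set A.
Proof. by case=> A1 AB _; split=> //; rewrite -(subrr 1); apply: AB. Qed.

Lemma subring_int A (m : int) : subring_set A -> A m%:~R.
Proof.
by move=> hA; apply: subgroup_setMz; [exact: subring_subgroup | case: hA].
Qed.

Lemma imaginary_quadratic_field K : imaginary_quadratic K ->
  subring_set K /\ forall x, K x -> K x^-1.
Proof.
case=> F [iota [_ -> _]]; split; first split.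
- by exists 1; rewrite ?rmorph1.
- by move=> _ _ [x _ <-] [y _ <-]; exists (x - y); rewrite ?rmorphB.
- by move=> _ _ [x _ <-] [y _ <-]; exists (x * y); rewrite ?rmorphM.
- by move=> _ [x _ <-]; exists x^-1; rewrite ?fmorphV.
Qed.

Lemma subring_ring_of_integers K :
  subring_set K -> subring_set (ring_of_integers K).
Proof.
case=> K1 KB KM; split; first by split=> //; exact: Aint1.
  by move=> x y [Kx Ax] [Ky Ay]; split; [apply: KB | apply: rpredB].
by move=> x y [Kx Ax] [Ky Ay]; split; [apply: KM | apply: rpredM].
Qed.

(** Modulo 4 the square of [e] is 0 or 1 according to its parity, so [b_of] has the parity of [e].
    It is applied with [e] the trace of a generator of the ring of integers, and with [e] the middle
    coefficient of a form. *)
Lemma b_of_parity (e f : int) : exists k, b_of (e ^+ 2 + 4 * f) = e + 2 * k.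
Proof.
rewrite /b_of.
have [q [r [Er r01]]] : exists q r : int, e = q * 2 + r /\ (r = 0 \/ r = 1).
  by exists (e %/ 2)%Z, (e %% 2)%Z; lia.
have -> : e ^+ 2 + 4 * f = (q ^+ 2 + q * r + f) * 4 + r.
  by case: r01 => ?; subst r e; ring.
by rewrite modzMDl; case: r01 Er => -> ->; exists (- q); rewrite /=; ring.
Qed.

(** The coordinates [m], [k] of 1 are coprime, so a Bezout relation completes 1 to a basis. The
    change of basis has determinant -1, hence keeps the discriminant. *)
Lemma exists_integral_basis_1 K w1 w2 : subring_set K ->
  ring_of_integers K = Zspan w1 w2 ->
  exists u v : int, let w := u%:~R * w2 - v%:~R * w1 in
    ring_of_integers K = Zspan w 1 /\
    (w1 * w2^* - w2 * w1^*) ^+ 2 = (w - w^*) ^+ 2.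
Proof.
move=> hK OE; have hO := subring_ring_of_integers hK.
have : ring_of_integers K 1 by case: hO.
rewrite {1}OE => /ZspanP[m [k E1]].
have [u [v g]] := Bezoutz m k.
have [m' Em] : exists m', m = m' * gcdz m k by apply/dvdzP; rewrite dvdz_gcdl.
have [k' Ek] : exists k', k = k' * gcdz m k by apply/dvdzP; rewrite dvdz_gcdr.
have g1 : gcdz m k = 1.
  have Ey : (gcdz m k)%:~R * (m'%:~R * w1 + k'%:~R * w2) = 1 :> algC.
    transitivity (m%:~R * w1 + k%:~R * w2); last by rewrite -E1.
    by rewrite mulrDr !mulrA -!intrM ![gcdz _ _ * _]mulrC -Em -Ek.
  (* The element [y] is the inverse of the gcd: a rational algebraic integer, hence an integer,
     which forces the gcd to be 1. *)
  set y := m'%:~R * w1 + _ in Ey.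
  have [_ Ay] : ring_of_integers K y by rewrite OE; apply/ZspanP; exists m', k'.
  have yE : y = (gcdz m k)%:~R^-1.
    by apply: (mulfI (x := (gcdz m k)%:~R)); rewrite ?Ey ?mulfV //;
       apply: contra_eq_neq Ey => ->; rewrite mul0r eq_sym oner_neq0.
  have /intrP[l El] : y \is a Num.int.
    by apply: Cint_rat_Aint => //; rewrite yE rpredV rpred_int.
  move: Ey; rewrite El -intrM -[1]/(1%:~R) => /intr_inj.
  have : 0 <= gcdz m k by [].
  by case: (lerP l 0); move: (gcdz m k) => g' *; nia.
rewrite g1 in g; exists u, v => w.
split.
  rewrite OE; apply: eq_Zspan.
  - apply/ZspanP; exists (- k), u.
    transitivity ((u * m + v * k)%:~R * w1); first by rewrite g mul1r.
    by rewrite [X in _ = _ + _ * X]E1 /w; ring.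
  - apply/ZspanP; exists m, v.
    transitivity ((u * m + v * k)%:~R * w2); first by rewrite g mul1r.
    by rewrite [X in _ = _ + _ * X]E1 /w; ring.
  - by apply/ZspanP; exists (- v), u; rewrite /w; ring.
  - by apply/ZspanP; exists m, k.
have E1' : 1 = m%:~R * w1^* + k%:~R * w2^*.
  have := congr1 (fun z => z^*) E1.
  by rewrite /= conjC1 rmorphD !rmorphM !rmorph_int.
(* The left side is the determinant of [w], 1 and their conjugates; both 1's are replaced by their
   expansions in the old basis. *)
have -> : w - w^* = - (u * m + v * k)%:~R * (w1 * w2^* - w2 * w1^*).
  transitivity (w * (m%:~R * w1^* + k%:~R * w2^*)
    - (m%:~R * w1 + k%:~R * w2) * w^*).
    by rewrite -E1 -E1' mul1r mulr1.
  by rewrite /w rmorphB !rmorphM !rmorph_int; ring.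
by rewrite g mulN1r sqrrN.
Qed.

(** Take a basis [w], 1 with [w ^+ 2 = e w + f]. The conjugate of [w] is [e - w], so
    [d = (2 w - e) ^+ 2 = e ^+ 2 + 4 f] and [sqrtC d%:~R] is [2 w - e] up to sign. By parity [tau d]
    then differs from [w] or [- w] by an integer. *)
Lemma ring_of_integersE K d : subring_set K -> discriminant K d -> d != 0 ->
  ring_of_integers K = Zspan (tau d) 1.
Proof.
move=> hK [w1 [w2 [[OE _] dE]]] d0.
have [u [v]] := exists_integral_basis_1 hK OE.
set w := _ - _ => -[{}OE dE']; rewrite {}dE' in dE.
have hO := subring_ring_of_integers hK.
have : ring_of_integers K (w * w).
  by case: hO => _ _; apply; rewrite OE; apply: Zspan_l.
rewrite {1}OE => /ZspanP[e [f E]].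
have E' : w^* * w^* = e%:~R * w^* + f%:~R * 1.
  by rewrite -rmorphM E rmorphD !rmorphM !rmorph_int rmorph1.
have ww0 : w - w^* != 0.
  by apply: contraNneq d0 => ww0; rewrite -(eqr_int algC) dE ww0 expr0n.
(* Subtract the quadratic equations of [w] and its conjugate and cancel their difference, nonzero
   since [d] is. *)
have Ew : w^* = e%:~R - w.
  apply/(mulfI ww0)/eqP; rewrite -subr_eq0; apply/eqP.
  transitivity ((e%:~R * w^* + f%:~R * 1 - w^* * w^*)
    - (e%:~R * w + f%:~R * 1 - w * w)).
    by ring.
  by rewrite -E -E' !subrr.
have d_ef : d = e ^+ 2 + 4 * f.
  apply: (@intr_inj algC); rewrite dE Ew.
  transitivity (4 * (w * w - e%:~R * w) + e%:~R ^+ 2); first by ring.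
  by rewrite E; ring.
have [k bE] := b_of_parity e f; rewrite -d_ef in bE.
have : sqrtC d%:~R ^+ 2 == (w - w^*) ^+ 2 by rewrite sqrtCK dE.
have tE : forall s : algC, s = w - (e%:~R - w) ->
     (- (b_of d)%:~R + s) / 2 = w - (e + k)%:~R
  /\ (- (b_of d)%:~R - s) / 2 = - w - k%:~R.
  by move=> s ->; rewrite bE; split; field.
rewrite eqf_sqr Ew OE /tau => /orP[] /eqP ->.
  rewrite (tE _ erefl).1; apply: eq_Zspan; apply/ZspanP.
  - by exists 1, (e + k); ring.
  - by exists 0, 1; ring.
  - by exists 1, (- (e + k)); ring.
  - by exists 0, 1; ring.
rewrite (tE _ erefl).2; apply: eq_Zspan; apply/ZspanP.
- by exists (-1), (- k); ring.
- by exists 0, 1; ring.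
- by exists (-1), (- k); ring.
- by exists 0, 1; ring.
Qed.

(** * Lattices attached to forms *)

Lemma image_mul_Zspan (nu x y : algC) :
  [set nu * z | z in Zspan x y] = Zspan (nu * x) (nu * y).
Proof.
apply/seteqP; split=> [_ [_ /ZspanP[m [k ->]] <-] | _ /ZspanP[m [k ->]]].
  by apply/ZspanP; exists m, k; ring.
exists (m%:~R * x + k%:~R * y); first by apply/ZspanP; exists m, k.
by ring.
Qed.

(** Squaring gives [m ^+ 2 = k ^+ 2 * d], whose sides have opposite signs unless both vanish. *)
Lemma sqrtC_neg_indep (d m k : int) : d < 0 ->
  m%:~R + k%:~R * sqrtC d%:~R = 0 :> algC -> m = 0 /\ k = 0.
Proof.
move=> d0 /eqP; rewrite addr_eq0 => /eqP E.
have : m ^+ 2 = k ^+ 2 * d.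
  apply: (@intr_inj algC); rewrite rmorphXn rmorphM rmorphXn /= E sqrrN exprMn.
  by rewrite sqrtCK.
by move=> H; have k0 : k = 0 by [nia]; subst k; split=> //; nia.
Qed.

Lemma forms_coefa_gt0 d Q : forms d Q -> 0 < coefa Q.
Proof.
case=> _ /(_ (delta_mx 0 0)); rewrite /bqf_eval !mxE /= => H _.
have := H _; rewrite !(mulr0, mulr1, addr0, expr0n, expr1n); apply.
by apply/eqP => /matrixP/(_ 0 0); rewrite !mxE.
Qed.

Lemma forms_disc_lt0 d Q : forms d Q -> d < 0.
Proof.
move=> hQ; have a0 := forms_coefa_gt0 hQ; case: hQ => _ hpos <-.
(* At this vector, where the form in [x] is minimal for fixed [y], its value is [coefa Q] times
   minus the discriminant. *)
pose v : 'cV[int]_2 := \col_i (if i == 0 then - coefb Q else 2 * coefa Q).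
have /hpos : v != 0.
  by apply/eqP => /matrixP/(_ 1 0); rewrite !mxE /=; lia.
rewrite /bqf_eval !mxE /= /bqf_disc => H.
have {}H : 0 < coefa Q * (4 * coefa Q * coefc Q - coefb Q ^+ 2).
  by move: H; congr (_ < _); ring.
by move: H; rewrite pmulr_rgt0 // subr_gt0 subr_lt0.
Qed.

Section Omega.
Variables (d : int) (Q : bqf).
Hypothesis hQ : forms d Q.

Lemma omegaE : 2 * (coefa Q)%:~R * omega Q = - (coefb Q)%:~R + sqrtC d%:~R.
Proof.
have a0 := forms_coefa_gt0 hQ; case: hQ => _ _ dQ.
rewrite /omega dQ mulrC divfK // mulf_neq0 ?pnatr_eq0 // intr_eq0; lia.
Qed.

Lemma omega_indep (m k : int) : m%:~R * omega Q + k%:~R = 0 -> m = 0 /\ k = 0.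
Proof.
move=> E; have a0 := forms_coefa_gt0 hQ.
have [] := @sqrtC_neg_indep d (2 * coefa Q * k - m * coefb Q) m
  (forms_disc_lt0 hQ).
  transitivity (2 * (coefa Q)%:~R * (m%:~R * omega Q + k%:~R));
    last by rewrite E mulr0.
  transitivity (2 * (coefa Q)%:~R * k%:~R
    + m%:~R * (2 * (coefa Q)%:~R * omega Q)); last by ring.
  by rewrite omegaE; ring.
by move=> H m0; split=> //; nia.
Qed.

Lemma omega_root : (coefa Q)%:~R * omega Q ^+ 2 + (coefb Q)%:~R * omega Q
   + (coefc Q)%:~R = 0.
Proof.
have a0 := forms_coefa_gt0 hQ.
apply/(mulfI (x := 4 * (coefa Q)%:~R)).
  by rewrite mulf_neq0 ?pnatr_eq0 // intr_eq0; lia.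
transitivity ((2 * (coefa Q)%:~R * omega Q + (coefb Q)%:~R) ^+ 2
   - ((coefb Q) ^+ 2 - 4 * coefa Q * coefc Q)%:~R); first by ring.
rewrite omegaE addrAC addNr add0r sqrtCK mulr0.
by case: hQ => _ _ <-; rewrite subrr.
Qed.

End Omega.

Definition mx2 (p q r s : int) : 'M[int]_2 :=
  \matrix_(i, j) if i == 0 then if j == 0 then p else q
                 else if j == 0 then r else s.

Lemma mx2E p q r s : [/\ mx2 p q r s 0 0 = p, mx2 p q r s 0 1 = q,
  mx2 p q r s 1 0 = r & mx2 p q r s 1 1 = s].
Proof. by rewrite !mxE. Qed.

(** Multiplying by [4 * coefa Q * coefa Q'] and using [omegaE] puts both sides in [Z + Z sqrt d].
    The first integer equation compares the coefficients of the root, the second the rational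
    parts. *)
Lemma omega_mul_eq d Q Q' (p q r s : int) : forms d Q -> forms d Q' ->
  (r%:~R * omega Q + s%:~R) * omega Q' = p%:~R * omega Q + q%:~R <->
  2 * coefa Q * s - r * coefb Q = 2 * coefa Q' * p + r * coefb Q' /\
  r * d - coefb Q' * (2 * coefa Q * s - r * coefb Q)
    = 2 * coefa Q' * (2 * coefa Q * q - p * coefb Q).
Proof.
move=> hQ hQ'; have a0 := forms_coefa_gt0 hQ; have A0 := forms_coefa_gt0 hQ'.
have aA0 : (4 * coefa Q * coefa Q')%:~R != 0 :> algC.
  by rewrite intr_eq0 !mulf_neq0 //; lia.
pose x := r * d - coefb Q' * (2 * coefa Q * s - r * coefb Q)
    - 2 * coefa Q' * (2 * coefa Q * q - p * coefb Q).
pose y := 2 * coefa Q * s - r * coefb Q - (2 * coefa Q' * p + r * coefb Q').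
have E : (4 * coefa Q * coefa Q')%:~R *
    ((r%:~R * omega Q + s%:~R) * omega Q' - (p%:~R * omega Q + q%:~R))
    = x%:~R + y%:~R * sqrtC d%:~R.
  transitivity ((r%:~R * (2 * (coefa Q)%:~R * omega Q)
        + 2 * (coefa Q)%:~R * s%:~R)
      * (2 * (coefa Q')%:~R * omega Q')
    - 2 * (coefa Q')%:~R * (p%:~R * (2 * (coefa Q)%:~R * omega Q)
        + 2 * (coefa Q)%:~R * q%:~R)).
    by ring.
  rewrite (omegaE hQ) (omegaE hQ') /x.
  have -> : (r * d - coefb Q' * (2 * coefa Q * s - r * coefb Q)
    - 2 * coefa Q' * (2 * coefa Q * q - p * coefb Q))%:~R =
    r%:~R * d%:~R - (coefb Q' * (2 * coefa Q * s - r * coefb Q)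
    + 2 * coefa Q' * (2 * coefa Q * q - p * coefb Q))%:~R :> algC by ring.
  by rewrite -[X in r%:~R * X - _]sqrtCK /y; ring.
split=> [H | [Hy Hx]].
  move: E; rewrite H subrr mulr0.
  move=> /esym/(sqrtC_neg_indep (forms_disc_lt0 hQ))[].
  by rewrite /x /y => /eqP + /eqP; rewrite !subr_eq0 => /eqP -> /eqP ->.
apply/eqP; rewrite -subr_eq0; apply/eqP/(mulfI aA0).
by rewrite E mulr0 /x /y Hx Hy !subrr mul0r addr0.
Qed.

(** The rows of [S] are the coordinates of [nu * omega Q'] and [nu] in the basis [omega Q], 1.
    Equality of lattices makes [S] invertible over the integers, positivity makes its determinant 1,
    and [Q] is then recovered from its leading coefficient and its root. *)
Lemma Zspan_omega_eq d Q Q' (nu : algC) : forms d Q -> forms d Q' ->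
  Zspan (omega Q) 1 = [set nu * z | z in Zspan (omega Q') 1] <->
  exists S : 'M[int]_2, [/\ \det S = 1, Q = bqf_act Q' S
    & nu = (S 1 0)%:~R * omega Q + (S 1 1)%:~R].
Proof.
move=> hQ hQ'; have a0 := forms_coefa_gt0 hQ; have A0 := forms_coefa_gt0 hQ'.
have d0 := forms_disc_lt0 hQ.
have dQ : bqf_disc Q = d by case: hQ.
have dQ' : bqf_disc Q' = d by case: hQ'.
rewrite image_mul_Zspan mulr1; split.
  move=> E.
  have : Zspan (omega Q) 1 nu by rewrite E; apply: Zspan_r.
  move=> /ZspanP[r [s]]; rewrite mulr1 => nuE.
  have : Zspan (omega Q) 1 (nu * omega Q') by rewrite E; apply: Zspan_l.
  move=> /ZspanP[p [q]]; rewrite mulr1 => nuwE.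
  have : Zspan (nu * omega Q') nu (omega Q) by rewrite -E; apply: Zspan_l.
  move=> /ZspanP[x [y Ew]].
  have : Zspan (nu * omega Q') nu 1 by rewrite -E; apply: Zspan_r.
  move=> /ZspanP[z [t E1]].
  have [xp xq] : x * p + y * r - 1 = 0 /\ x * q + y * s = 0.
    apply: (omega_indep hQ); move/eqP: Ew.
    rewrite nuwE nuE -subr_eq0 => /eqP Ew.
    by rewrite -[RHS]oppr0 -Ew; ring.
  have [zp zq] : z * p + t * r = 0 /\ z * q + t * s - 1 = 0.
    apply: (omega_indep hQ); move/eqP: E1.
    rewrite nuwE nuE -subr_eq0 => /eqP E1.
    by rewrite -[RHS]oppr0 -E1; ring.
  (* The matrices [(x, y; z, t)] and [(p, q; r, s)] are mutually inverse changes of basis, so their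
     determinants multiply to 1. *)
  have det1 : (x * t - y * z) * (p * s - q * r) = 1.
    transitivity ((x * p + y * r - 1 + 1) * (z * q + t * s - 1 + 1) -
      (x * q + y * s) * (z * p + t * r)); first by ring.
    by rewrite xp xq zp zq.
  have [e1 e2] :
      2 * coefa Q * s - r * coefb Q = 2 * coefa Q' * p + r * coefb Q' /\
      r * d - coefb Q' * (2 * coefa Q * s - r * coefb Q)
        = 2 * coefa Q' * (2 * coefa Q * q - p * coefb Q).
    by apply/(omega_mul_eq p q r s hQ hQ'); rewrite -nuE.
  (* As [d < 0] the right side is nonnegative, which excludes determinant -1. It also equals
     [4 * coefa Q'] times the value of [Q'] at [(p, r)], which yields [aE] below. *)
  have D : 4 * coefa Q' * coefa Q * (p * s - q * r)
      = (2 * coefa Q' * p + r * coefb Q') ^+ 2 - r ^+ 2 * d.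
    transitivity (2 * coefa Q' * p * (2 * coefa Q * s - r * coefb Q)
      - r * (2 * coefa Q' * (2 * coefa Q * q - p * coefb Q))); first by ring.
    by rewrite -e2 e1; ring.
  have det_ge0 : 0 <= p * s - q * r.
    have Aa0 : 0 < 4 * coefa Q' * coefa Q by rewrite !mulr_gt0.
    rewrite -(pmulr_rge0 _ Aa0) D subr_ge0.
    by apply: (le_trans (y := 0)); [nia | exact: sqr_ge0].
  have det_eq1 : p * s - q * r = 1.
    move: det_ge0 det1; move: (x * t - _) (p * s - _) => e D' D'0.
    by case: (lerP e 0) => *; nia.
  have aE : coefa Q = coefa Q' * p ^+ 2 + coefb Q' * p * r + coefc Q' * r ^+ 2.
    apply: (mulfI (x := 4 * coefa Q')); first by lia.
    transitivity (4 * coefa Q' * coefa Q * (p * s - q * r)).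
      by rewrite det_eq1 mulr1.
    rewrite D -dQ' /bqf_disc; ring.
  exists (mx2 p q r s); case: (mx2E p q r s) => S00 S01 S10 S11.
  rewrite det_mx2E S00 S01 S10 S11; split=> //.
  (* The homogenised equation of [omega Q']: after expanding in [omega Q] it says that the
     transformed form has root [omega Q]. *)
  have H : (nu * omega Q') ^+ 2 * (coefa Q')%:~R
      + (nu * omega Q') * nu * (coefb Q')%:~R
      + nu ^+ 2 * (coefc Q')%:~R = 0.
    transitivity (nu ^+ 2 * ((coefa Q')%:~R * omega Q' ^+ 2
      + (coefb Q')%:~R * omega Q'
      + (coefc Q')%:~R)); first by ring.
    by rewrite (omega_root hQ') mulr0.
  have R := omega_root hQ.
  (* [Q1] and [Q] share the root [omega Q] and the leading coefficient, so subtracting their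
     equations leaves a linear relation between [omega Q] and 1. *)
  set Q1 := bqf_act Q' (mx2 p q r s).
  have [] := @omega_indep d Q hQ
    (coefb Q1 - coefb Q) (coefc Q1 - coefc Q).
    transitivity (((coefa Q1)%:~R * omega Q ^+ 2 + (coefb Q1)%:~R * omega Q
        + (coefc Q1)%:~R) - ((coefa Q)%:~R * omega Q ^+ 2
        + (coefb Q)%:~R * omega Q + (coefc Q)%:~R)).
      rewrite aE /Q1; case: (Q') => A B C /=; rewrite S00 S01 S10 S11; ring.
    rewrite R subr0 -[RHS]H nuwE nuE /Q1.
    case: (Q') => A B C /=; rewrite S00 S01 S10 S11; ring.
  move: aE; rewrite /Q1; case: (Q) (Q') => a b c [A B C] /=.
  rewrite S00 S01 S10 S11 => -> /eqP + /eqP.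
  by rewrite !subr_eq0 => /eqP <- /eqP <-.
case=> S [dS ES nuE].
have [aE bE] : coefa Q = coefa Q' * S 0 0 ^+ 2
      + coefb Q' * S 0 0 * S 1 0 + coefc Q' * S 1 0 ^+ 2
  /\ coefb Q = 2 * coefa Q' * S 0 0 * S 0 1
         + coefb Q' * (S 0 0 * S 1 1 + S 0 1 * S 1 0)
         + 2 * coefc Q' * S 1 0 * S 1 1.
  by rewrite ES; case: (Q').
rewrite det_mx2E in dS.
have nuwE : nu * omega Q' = (S 0 0)%:~R * omega Q + (S 0 1)%:~R.
  rewrite nuE; apply/(omega_mul_eq _ _ _ _ hQ hQ').
  have e1 : 2 * coefa Q * S 1 1 - S 1 0 * coefb Q
      = 2 * coefa Q' * S 0 0 + S 1 0 * coefb Q'.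
    transitivity ((2 * coefa Q' * S 0 0 + S 1 0 * coefb Q')
      * (S 0 0 * S 1 1 - S 0 1 * S 1 0)); last by rewrite dS mulr1.
    rewrite aE bE; ring.
  split=> //; rewrite e1 -dQ' /bqf_disc.
  (* The two sides agree only up to a factor [\det S], which is inserted as 1 before [ring]. *)
  pose z := 2 * coefa Q' * (S 0 0 * coefb Q' + 2 * coefc Q' * S 1 0).
  transitivity (- z); first by rewrite /z; ring.
  transitivity (- z * (S 0 0 * S 1 1 - S 0 1 * S 1 0));
    first by rewrite dS mulr1.
  rewrite /z aE bE; ring.
have dS' : (S 0 0)%:~R * (S 1 1)%:~R - (S 0 1)%:~R * (S 1 0)%:~R = 1 :> algC.
  by rewrite -!intrM -intrB dS.
(* The first two inclusions use the entries of the inverse of [S], the last two those of [S]. *)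
apply: eq_Zspan; apply/ZspanP.
- exists (S 1 1), (- S 0 1); rewrite nuwE nuE.
  transitivity (((S 0 0)%:~R * (S 1 1)%:~R
    - (S 0 1)%:~R * (S 1 0)%:~R) * omega Q).
    by rewrite dS' mul1r.
  by ring.
- exists (- S 1 0), (S 0 0); rewrite nuwE nuE.
  by rewrite -[LHS]dS'; ring.
- by exists (S 0 0), (S 0 1); rewrite nuwE mulr1.
- by exists (S 1 0), (S 1 1); rewrite nuE mulr1.
Qed.

(** * Ray classes *)

Lemma ideal_subgroup K n : subring_set K -> ideal K n -> subgroup_set n.
Proof.
move=> hK [_ n0 nD nM]; split=> // x y nx ny; apply: nD => //.
by rewrite -mulN1r; apply: nM => //;
   apply: (subring_int (- 1) (subring_ring_of_integers hK)).
Qed.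

Lemma ideal_principal K x : subring_set K -> ring_of_integers K x ->
  ideal K (principal K x).
Proof.
move=> hK Ox; have hO := subring_ring_of_integers hK.
have [_ _ OM] := hO; have hS := subring_subgroup hO; split.
- by move=> _ [r Or <-]; apply: OM.
- by exists 0; [exact: hS.1 | rewrite mulr0].
- move=> _ _ [r Or <-] [t Ot <-].
  by exists (r + t); [exact: subgroup_setD | rewrite mulrDr].
- by move=> r _ Or [t Ot <-]; exists (r * t); [exact: OM | rewrite mulrCA].
Qed.

Lemma coprime_idealsP K A n : subring_set K -> ideal K A -> ideal K n ->
  coprime_ideals K A n <-> exists2 x, A x & n (1 - x).
Proof.
move=> hK hA hn; have hO := subring_ring_of_integers hK.
rewrite /coprime_ideals; split=> [E | [x Ax nx]].
  have : ring_of_integers K 1 by case: hO.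
  by rewrite -E => -[x [y [Ax ny ->]]]; exists x; rewrite // addrAC subrr add0r.
case: hA hn => AO _ _ AM [nO _ _ nM]; apply/seteqP; split.
  move=> _ [y [z [Ay nz ->]]].
  by apply: subgroup_setD; [exact: subring_subgroup | exact: AO | exact: nO].
move=> z Oz; exists (z * x), (z * (1 - x)).
by split; [exact: AM | exact: nM | ring].
Qed.

Lemma coprime_principalP K x n :
  subring_set K -> ring_of_integers K x -> ideal K n ->
  coprime_ideals K (principal K x) n <->
  exists2 r, ring_of_integers K r & n (1 - x * r).
Proof.
move=> hK Ox hn; rewrite (coprime_idealsP hK (ideal_principal hK Ox) hn).
by split=> [[_ [r Or <-]] ? | [r Or ?]];
   [exists r | exists (x * r) => //; exists r].
Qed.

Lemma coprime_principalM K x y n :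
  subring_set K -> ring_of_integers K x -> ring_of_integers K y -> ideal K n ->
  coprime_ideals K (principal K x) n -> coprime_ideals K (principal K y) n ->
  coprime_ideals K (principal K (x * y)) n.
Proof.
move=> hK Ox Oy hn; have [_ _ OM] := subring_ring_of_integers hK.
move=> /coprime_principalP[] // r Or nr /coprime_principalP[] // t Ot nt.
apply/coprime_principalP => //; first exact: OM.
exists (r * t); first exact: OM.
have -> : 1 - x * y * (r * t) = (1 - x * r) + x * r * (1 - y * t) by ring.
by case: hn => _ _ nD nM; apply: nD => //; apply: nM => //; apply: OM.
Qed.

Lemma mcong1_1 K n : subring_set K -> ideal K n -> mcong1 K n 1.
Proof.
move=> hK hn; have hO := subring_ring_of_integers hK; have [O1 _ _] := hO.
have n0 : n 0 by case: hn.
have c1 : coprime_ideals K (principal K 1) n.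
  by apply/coprime_principalP => //; exists 1; rewrite // mulr1 subrr.
by exists 1, 1; rewrite !oner_neq0 subrr divr1.
Qed.

Lemma mcong1V K n nu : subring_set K -> ideal K n ->
  mcong1 K n nu -> mcong1 K n nu^-1.
Proof.
move=> hK hn [x [y [[Ox Oy] [x0 y0] [cx cy] nxy ->]]].
exists y, x; split=> //; last by rewrite invf_div.
by rewrite -opprB; apply: subgroup_setN => //; apply: ideal_subgroup hn.
Qed.

Lemma mcong1M K n nu mu : subring_set K -> ideal K n ->
  mcong1 K n nu -> mcong1 K n mu -> mcong1 K n (nu * mu).
Proof.
move=> hK hn; have [_ _ OM] := subring_ring_of_integers hK.
move=> [x [y [[Ox Oy] [x0 y0] [cx cy] nxy ->]]].
move=> [z [t [[Oz Ot] [z0 t0] [cz ct] nzt ->]]].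
exists (x * z), (y * t); split.
- by split; apply: OM.
- by split; apply: mulf_neq0.
- by split; apply: coprime_principalM.
- have -> : x * z - y * t = z * (x - y) + y * (z - t) by ring.
  by case: hn => _ _ nD nM; apply: nD; apply: nM.
- by rewrite mulf_div.
Qed.

(** The congruence does not depend on the fraction chosen. If [x / y = x' / y'] with [x' - y'] in
    [n], then [(x - y) * y' = y * (x' - y')] lies in [n], and [y'] is invertible modulo [n].
    Conversely [x], being congruent to [y], is prime to [n] as well. *)
Lemma mcong1_divE K n x y : subring_set K -> ideal K n ->
  ring_of_integers K x -> ring_of_integers K y -> x != 0 -> y != 0 ->
  coprime_ideals K (principal K y) n ->
  mcong1 K n (x / y) <-> n (x - y).
Proof.
move=> hK hn Ox Oy x0 y0 cy; have hO := subring_ring_of_integers hK.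
have [_ OB OM] := hO; have [_ _ nD nM] := hn; split.
  move=> [x' [y' [[Ox' Oy'] [x'0 y'0] [_ cy'] nxy' E]]].
  have [r Or nr] := (coprime_principalP hK Oy' hn).1 cy'.
  have {}E : x * y' = x' * y by apply/eqP; rewrite -eqr_div // E.
  have -> : x - y = (x - y) * (1 - y' * r) + r * (y * (x' - y')).
    transitivity ((x - y) * (1 - y' * r) + r * (x' * y - y * y')); last by ring.
    by rewrite -E; ring.
  by apply: nD; [apply: nM => //; apply: OB | apply: (nM) => //; apply: nM].
move=> nxy; exists x, y; split=> //; split=> //.
have [r Or nr] := (coprime_principalP hK Oy hn).1 cy.
apply/coprime_principalP => //; exists r => //.
have -> : 1 - x * r = (1 - y * r) - r * (x - y) by ring.
by apply: (ideal_subgroup hK hn).2 => //; apply: nM.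
Qed.

Definition integral_module K (A : set algC) : Prop :=
  subgroup_set A /\ forall r x, ring_of_integers K r -> A x -> A (r * x).

Lemma ideal_mul_principal K A nu : subring_set K -> integral_module K A ->
  ideal_mul A (principal K nu) = [set nu * z | z in A].
Proof.
move=> hK [hA AM]; have [O1 _ _] := subring_ring_of_integers hK.
apply/seteqP; split=> [_ [s [hs ->]] | _ [z Az <-]].
  elim: s hs => [|[x y] s IHs] hs.
    by rewrite big_nil; exists 0; [exact: hA.1 | rewrite mulr0].
  have [|z Az Ez] := IHs; first by move=> p ps; apply: hs; rewrite inE ps orbT.
  have [/= Ax [r Or <-]] := hs (x, y) (mem_head _ _).
  rewrite big_cons -Ez /=; exists (r * x + z); last by ring.
  by apply: subgroup_setD => //; apply: AM.
exists [:: (z, nu)]; split; last by rewrite big_seq1 mulrC.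
by move=> p; rewrite inE => /eqP -> /=; split=> //; exists 1; rewrite ?mulr1.
Qed.

Lemma integral_module_scale K A nu :
  integral_module K A -> integral_module K [set nu * z | z in A].
Proof.
move=> [[A0 AB] AM]; split; first split.
- by exists 0; rewrite ?mulr0.
- by move=> _ _ [x Ax <-] [y Ay <-]; exists (x - y);
     [exact: AB | rewrite mulrBr].
- by move=> r _ Or [x Ax <-]; exists (r * x); [exact: AM | rewrite mulrCA].
Qed.

(** Cosets of a group coincide exactly when one contains a representative of the other; the group
    laws of the ray are [mcong1_1], [mcong1M] and [mcong1V]. *)
Lemma ray_class_eqP K n A B : subring_set K -> (forall x, K x -> K x^-1) ->
  ideal K n -> integral_module K A -> integral_module K B ->
  ray_class K n A = ray_class K n B <->
  exists nu, [/\ K nu, nu != 0, mcong1 K n nu & A = [set nu * z | z in B]].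
Proof.
move=> hK KV hn hA hB; have [K1 _ KM] := hK.
have rayE C X : integral_module K C -> ray_class K n C X <->
    exists nu, [/\ K nu, nu != 0, mcong1 K n nu & X = [set nu * z | z in C]].
  move=> hC; split=> [[_ [nu [Knu nu0 cnu] <-] <-] | [nu [Knu nu0 cnu ->]]].
    by exists nu; split; rewrite // ideal_mul_principal.
  exists (principal K nu); last by rewrite ideal_mul_principal.
  by exists nu.
split=> [E | [nu [Knu nu0 cnu AE]]].
  have : ray_class K n A A.
    apply/rayE => //; exists 1; split; rewrite ?oner_neq0 //.
      exact: mcong1_1.
    by under eq_imagel => z _ do rewrite mul1r; rewrite image_id.
  by rewrite E => /rayE; apply.
have imM mu mu' C : [set mu * z | z in [set mu' * z | z in C]]
    = [set mu * mu' * z | z in C].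
  by rewrite image_comp; apply: eq_imagel => z _ /=; rewrite mulrA.
apply/seteqP; split=> X /rayE[] // mu [Kmu mu0 cmu ->]; apply/rayE => //.
  exists (mu * nu); split; [exact: KM | exact: mulf_neq0 | exact: mcong1M |].
  by rewrite AE imM.
exists (mu / nu); split; [by apply: KM => //; apply: KV | | |].
- by rewrite mulf_neq0 // invr_eq0.
- by apply: mcong1M => //; apply: mcong1V.
- by rewrite AE imM divfK.
Qed.

(** * Lattices of forms as fractional ideals prime to the modulus *)

(** Both [coefa Q] times [omega Q] and [tau d] have imaginary part half of that of [sqrtC d%:~R];
    they differ by the integer [k], as [coefb Q] and [b_of d] have the same parity. *)
Lemma coefa_omega_tau d Q : forms d Q -> exists k,
  b_of d - coefb Q = k * 2 /\ (coefa Q)%:~R * omega Q = tau d + k%:~R.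
Proof.
move=> hQ; have [k bE] := b_of_parity (coefb Q) (- (coefa Q * coefc Q)).
have dE : coefb Q ^+ 2 + 4 * - (coefa Q * coefc Q) = d.
  by case: hQ => _ _ <-; rewrite /bqf_disc; ring.
rewrite dE in bE; exists k; split; first by rewrite bE; ring.
have t0 : 2 != 0 :> algC by rewrite pnatr_eq0.
apply: (mulfI t0); rewrite mulrA (omegaE hQ) /tau mulrDr mulrCA divff //.
by rewrite mulr1 bE; ring.
Qed.

Section Class.
Variables (K n : set algC) (d N : int).
Hypotheses (hK : subring_set K) (KV : forall x, K x -> K x^-1).
Hypotheses (OE : ring_of_integers K = Zspan (tau d) 1).
Hypotheses (hn : ideal K n) (nN : n N%:~R).

Lemma coprime_int a :
  gcdz N a = 1 -> coprime_ideals K (principal K a%:~R) n.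
Proof.
move=> g; have hO := subring_ring_of_integers hK.
have [u [v]] := Bezoutz N a; rewrite g => E.
apply/coprime_principalP => //; first exact: subring_int.
exists v%:~R; first exact: subring_int.
have -> : 1 - a%:~R * v%:~R = u%:~R * N%:~R :> algC.
  by apply/eqP; rewrite subr_eq -!intrM -intrD [a * v]mulrC E.
by case: hn => _ _ _ nM; apply: nM => //; apply: subring_int.
Qed.

Variable Q : bqf.
Hypothesis hQ : forms d Q.

Lemma integer_coefa_omega : ring_of_integers K ((coefa Q)%:~R * omega Q).
Proof.
have [k [_ ->]] := coefa_omega_tau hQ; rewrite OE.
by apply/ZspanP; exists 1, k; ring.
Qed.

Lemma mem_omega : K (omega Q).
Proof.
have a0 : (coefa Q)%:~R != 0 :> algC.
  by rewrite intr_eq0; have := forms_coefa_gt0 hQ; lia.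
have [_ _ KM] := hK.
rewrite -[omega Q](mulKf a0); apply: KM; last by case: integer_coefa_omega.
by apply: KV; apply: subring_int.
Qed.

(** Up to an integer [tau d] is [coefa Q] times [omega Q], and the quadratic equation rewrites
    [coefa Q] times the square of [omega Q] as an integral combination of [omega Q] and 1. *)
Lemma integral_module_Zspan_omega : integral_module K (Zspan (omega Q) 1).
Proof.
split=> [|r x]; first exact: subgroup_Zspan.
have [k [_ Ek]] := coefa_omega_tau hQ.
have R := omega_root hQ.
rewrite OE => /ZspanP[m [l ->]] /ZspanP[x1 [y1 ->]].
have -> : tau d = (coefa Q)%:~R * omega Q - k%:~R by rewrite Ek addrK.
apply/ZspanP; exists (m * x1 * - coefb Q + m * y1 * coefa Q + (l - m * k) * x1),
  (- m * x1 * coefc Q + (l - m * k) * y1).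
apply/eqP; rewrite -subr_eq0; apply/eqP.
transitivity ((m * x1)%:~R * ((coefa Q)%:~R * omega Q ^+ 2
   + (coefb Q)%:~R * omega Q + (coefc Q)%:~R)); first by ring.
by rewrite R mulr0.
Qed.

(** The lattice is the quotient of [B], its multiple by [coefa Q], by the principal ideal of
    [coefa Q]. Both are integral and contain [coefa Q], which is prime to [N] and so to [n]. *)
Lemma prime_to_Zspan_omega :
  gcdz N (coefa Q) = 1 -> ideals_prime_to K n (Zspan (omega Q) 1).
Proof.
move=> g; have hO := subring_ring_of_integers hK.
have [O1 _ OM] := hO; have [K1 _ KM] := hK.
have [hA AM] := integral_module_Zspan_omega.
have a0 : (coefa Q)%:~R != 0 :> algC.
  by rewrite intr_eq0; have := forms_coefa_gt0 hQ; lia.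
have Oa : ring_of_integers K (coefa Q)%:~R by apply: subring_int.
pose B := [set (coefa Q)%:~R * z | z in Zspan (omega Q) 1].
have aA : B `<=` ring_of_integers K.
  rewrite /B image_mul_Zspan mulr1; apply: Zspan_subset => //.
  - exact: subring_subgroup.
  - exact: integer_coefa_omega.
have hB : ideal K B.
  have [hB BM] := integral_module_scale (coefa Q)%:~R (conj hA AM).
  split=> //; first by case: hB.
  by move=> x y; apply: subgroup_setD.
have aB : B (coefa Q)%:~R.
  by exists 1; [exact: Zspan_r | rewrite mulr1].
split.
  split=> //.
  - apply: Zspan_subset => //; [exact: subring_subgroup | exact: mem_omega].
  - by exists 1; [exact: Zspan_r | rewrite oner_neq0].
  - by move=> x y; apply: subgroup_setD.
  - by exists (coefa Q)%:~R; split=> // x Ax; apply: aA; exists x.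
have cC := coprime_int g.
exists B, (principal K (coefa Q)%:~R).
split=> //.
- by split=> //; exists (coefa Q)%:~R.
- apply/coprime_idealsP => //.
  have [r Or nr] := (coprime_principalP hK Oa hn).1 cC.
  exists ((coefa Q)%:~R * r) => //; rewrite mulrC.
  by case: hB => _ _ _; apply.
- split; first exact: ideal_principal.
  by exists (coefa Q)%:~R => //; exists 1; rewrite ?mulr1.
- exact: ideal_mul_principal.
Qed.

End Class.

(** * Membership in the modulus as congruences *)

Lemma tau_indep (d m k : int) : d < 0 ->
  m%:~R * tau d + k%:~R = 0 -> m = 0 /\ k = 0.
Proof.
move=> d0 E.
have [] := @sqrtC_neg_indep d (2 * k - m * b_of d) m d0.
  transitivity (2 * (m%:~R * tau d + k%:~R)); last by rewrite E mulr0.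
  by rewrite /tau; field.
by move=> H m0; split=> //; nia.
Qed.

(** Comparing coordinates with [x (a1 tau + a2) + y N] gives [r = x a1] and [m = x a2 + y N], where
    [x a2 = r (a2 / a1)] since [a1] divides [a2]. *)
Lemma canonical_basisP d n N a1 a2 (r m : int) : d < 0 ->
  canonical_basis d n N a1 a2 ->
  n (r%:~R * tau d + m%:~R) <->
  (a1 %| r)%Z /\ (N %| m - r * (a2 %/ a1)%Z)%Z.
Proof.
move=> d0 [/andP[a10 a1N] _ _ /dvdzP[t ->] [-> _]].
rewrite mulzK; last by lia.
split=> [/ZspanP[x [y E]] | [/dvdzP[x ->] /dvdzP[y /eqP]]].
  have [/eqP + /eqP] : r - x * a1 = 0 /\ m - (x * (t * a1) + y * N) = 0.
    apply: (tau_indep d0); move/eqP: E; rewrite -subr_eq0 => /eqP E.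
    by rewrite -[RHS]E; ring.
  rewrite !subr_eq0 => /eqP -> /eqP ->; split; first exact: dvdz_mull.
  by apply/dvdzP; exists y; ring.
rewrite subr_eq => /eqP ->; apply/ZspanP; exists x, y; ring.
Qed.

(** The multiplier [nu] given by the bottom row of [S] is the fraction [(coefa Q * nu) / coefa Q] of
    integral elements with denominator prime to [n], so [mcong1_divE] turns its congruence into
    membership in [n]. *)
Lemma form_equivP K n d N Q Q' : subring_set K -> (forall x, K x -> K x^-1) ->
  ring_of_integers K = Zspan (tau d) 1 -> ideal K n -> n N%:~R ->
  forms_prime_to N d Q -> forms_prime_to N d Q' ->
  form_equiv K n Q Q' <->
  exists S : 'M[int]_2, [/\ \det S = 1, Q = bqf_act Q' S
    & n ((S 1 0)%:~R * ((coefa Q)%:~R * omega Q)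
         + ((S 1 1 - 1) * coefa Q)%:~R)].
Proof.
move=> hK KV OE hn nN [hQ gQ] [hQ' gQ'].
have hO := subring_ring_of_integers hK; have [O1 _ OM] := hO.
have a0 : (coefa Q)%:~R != 0 :> algC.
  by rewrite intr_eq0; have := forms_coefa_gt0 hQ; lia.
have Oaw := integer_coefa_omega OE hQ.
have Oint m : ring_of_integers K m%:~R by apply: subring_int.
have ca := coprime_int hK hn nN gQ.
have nuP (r s : int) (nu := r%:~R * omega Q + s%:~R) : nu != 0 ->
    mcong1 K n nu <->
    n (r%:~R * ((coefa Q)%:~R * omega Q) + ((s - 1) * coefa Q)%:~R).
  move=> nu0; have -> : nu = (coefa Q)%:~R * nu / (coefa Q)%:~R.
    by rewrite mulrC mulKf.
  rewrite mcong1_divE //; last by rewrite mulf_neq0.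
    suff -> : (coefa Q)%:~R * nu - (coefa Q)%:~R =
      r%:~R * ((coefa Q)%:~R * omega Q) + ((s - 1) * coefa Q)%:~R by [].
    by rewrite /nu; ring.
  have -> : (coefa Q)%:~R * nu =
      r%:~R * ((coefa Q)%:~R * omega Q) + (s * coefa Q)%:~R.
    by rewrite /nu; ring.
  by apply: subgroup_setD => //; [exact: subring_subgroup | exact: OM].
rewrite /form_equiv /same_ray_class.
have mQ := integral_module_Zspan_omega OE hQ.
have mQ' := integral_module_Zspan_omega OE hQ'.
split=> [[_ _ /(ray_class_eqP hK KV hn mQ mQ')] | [S [dS QE nS]]].
  move=> [nu [Knu nu0 cnu]] /(Zspan_omega_eq _ hQ hQ')[S [dS QE nuE]].
  exists S; split=> //; by apply/nuP; rewrite -nuE.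
split; [exact: (prime_to_Zspan_omega hK KV OE hn nN hQ gQ)
  | exact: (prime_to_Zspan_omega hK KV OE hn nN hQ' gQ') |].
apply/ray_class_eqP => //.
set nu := (S 1 0)%:~R * omega Q + (S 1 1)%:~R.
(* Otherwise the bottom row of [S] would vanish, against determinant 1. *)
have nu0 : nu != 0.
  apply/eqP => /(omega_indep hQ)[r0 s0].
  by move: dS; rewrite det_mx2E r0 s0 !mulr0.
exists nu; split=> //.
- have [_ _ KM] := hK; apply: subgroup_setD; first exact: subring_subgroup.
    by apply: KM; [exact: subring_int | exact: (mem_omega hK KV OE hQ)].
  exact: subring_int.
- exact/nuP.
- by apply/(Zspan_omega_eq _ hQ hQ'); exists S.
Qed.

(** Modulo [N], multiplication by [a'] undoes multiplication by [a]; the witnesses correct for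
    [a * a' = l * N + 1]. *)
Lemma dvdz_cancel_inv (N a a' s x : int) : (a * a' = 1 %[mod N])%Z ->
  (N %| (s - 1) * a - x)%Z <-> (s = (1 + a' * x)%R %[mod N])%Z.
Proof.
move=> /eqP; rewrite eqz_mod_dvd => /dvdzP[l El].
have {}El : a * a' = l * N + 1 by rewrite -El subrK.
split=> [/dvdzP[m Em] | /eqP].
  apply/eqP; rewrite eqz_mod_dvd; apply/dvdzP; exists (a' * m - (s - 1) * l).
  transitivity (a' * ((s - 1) * a - x) - (s - 1) * (a * a') + (s - 1)).
    by ring.
  by rewrite Em El; ring.
rewrite eqz_mod_dvd => /dvdzP[m Em]; apply/dvdzP; exists (a * m + x * l).
have -> : s = m * N + (1 + a' * x) by rewrite -Em subrK.
transitivity (a * m * N + a * a' * x - x); first by ring.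
by rewrite El; ring.
Qed.

(* The quotients a2 / a1 and (b_K - b) / 2 are exact. *)
Theorem proposition2p8
  (K : set algC) (hK : imaginary_quadratic K)
  (d : int) (hd : discriminant K d)
  (n : set algC) (hn : nonzero_ideal K n)
  (N : int) (hN : least_positive n N)
  (a1 a2 : int) (hbasis : canonical_basis d n N a1 a2)
  (Q Q' : bqf) (hQ : forms_prime_to N d Q) (hQ' : forms_prime_to N d Q')
  (a' : int) (ha' : (coefa Q * a' = 1 %[mod N])%Z) :
  form_equiv K n Q Q' <->
  exists (g : 'M[int]_2) (u v : int),
    [/\ Gamma N a1 g,
        ((g 1 0 * v + g 1 1)%R
           = (1 + a' * ((a2 %/ a1)%Z - ((b_of d - coefb Q) %/ 2)%Z) * g 1 0)%R
           %[mod N])%Z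
      & Q = bqf_act Q' (Tmx ^ u * g * Tmx ^ v)].
Proof.
have [hK' KV] := imaginary_quadratic_field hK.
have d0 : d < 0 by case: hQ => hQ _; exact: forms_disc_lt0 hQ.
have OE := ring_of_integersE hK' hd (ltr0_neq0 d0).
have nN : n N%:~R by case: hN.
have a1N : (a1 %| N)%Z by case: hbasis.
rewrite (form_equivP hK' KV OE hn.1 nN hQ hQ').
rewrite (exists_Gamma_conj _ (fun S => Q = bqf_act Q' S) a1N).
have [k [bE wE]] := coefa_omega_tau hQ.1.
rewrite bE mulzK // wE.
(* Both sides now ask for a matrix [S] of determinant 1 with [Q = bqf_act Q' S]; only the conditions
   on its bottom row remain to be matched. *)
have E (S : 'M[int]_2) :
    n ((S 1 0)%:~R * (tau d + k%:~R) + ((S 1 1 - 1) * coefa Q)%:~R) <->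
    (a1 %| (S 1 0)%R)%Z /\
    ((S 1 1)%R = (1 + a' * ((a2 %/ a1)%Z - k) * S 1 0)%R %[mod N])%Z.
  have -> : (S 1 0)%:~R * (tau d + k%:~R) + ((S 1 1 - 1) * coefa Q)%:~R =
      (S 1 0)%:~R * tau d + (S 1 0 * k + (S 1 1 - 1) * coefa Q)%:~R by ring.
  rewrite (canonical_basisP _ _ d0 hbasis) -mulrA -(dvdz_cancel_inv _ _ ha').
  have -> // : S 1 0 * k + (S 1 1 - 1) * coefa Q - S 1 0 * (a2 %/ a1)%Z =
    (S 1 1 - 1) * coefa Q - ((a2 %/ a1)%Z - k) * S 1 0 by ring.
split=> [[S [dS QE /E[]]] | [S [dS a1S SE QE]]]; exists S; split=> //.
exact/E.
Qed.
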